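(* Let $\mathbb{K}=\mathbb{R}$ or $\mathbb{C}$ and let $A\in\mathbb{K}^{m\times n}$, $B\in\mathbb{K}^{n\times k}$. Then $(AB)^{+}=B^{+}A^{+}$ if and only if $P=B(AB)^{+}A$ is an orthogonal projection (i.e. $P^2=P$ and $P^*=P$).
   Context: $M^*$ is the conjugate transpose and $M^{+}$ the Moore--Penrose pseudoinverse of $M$. *)

(* Defs.v *)
From HB Require Import structures.
From mathcomp Require Import all_boot all_order all_algebra.
From mathcomp Require Import boolp classical_sets reals complex.

Set Implicit Arguments.
Unset Strict Implicit.
Unset Printing Implicit Defensive.
Import Order.TTheory GRing.Theory Num.Theory.
Local Open Scope ring_scope.

(* The real and complex cases share their definitions through the conjugation
   theta of the field K: idfun when K is the real field R, and Num.conj when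
   K = R[i]. The matrix M ^* is M ^t theta, i.e. map_mx theta M^T. *)

Section MoorePenrose.
Local Open Scope sesquilinear_scope.
Variables (K : numFieldType) (theta : K -> K).

Definition orthogonal_projection n (P : 'M[K]_n) : Prop :=
  P *m P = P /\ P ^t theta = P.

Definition penrose m n (M : 'M[K]_(m, n)) (X : 'M[K]_(n, m)) : Prop :=
  [/\ M *m X *m M = M,
      X *m M *m X = X,
      (M *m X) ^t theta = M *m X
    & (X *m M) ^t theta = X *m M].

(* The default value 0 is never used when theta is one of the two conjugations
   above: see mpinvP_real, mpinvP_complex and penrose_unique. *)
Definition mpinv m n (M : 'M[K]_(m, n)) : 'M[K]_(n, m) :=
  xget 0 [set X | penrose M X]%classic.

End MoorePenrose.

Section Existence.
Local Open Scope sesquilinear_scope.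
Variables (K : numFieldType) (theta : {rmorphism K -> K}).
Hypothesis thetaM : forall x, x * theta x = `|x| ^+ 2.
Hypothesis thetaK : involutive theta.

Lemma adjmxM m n p (A : 'M[K]_(m, n)) (B : 'M[K]_(n, p)) :
  (A *m B) ^t theta = B ^t theta *m A ^t theta.
Proof. by rewrite trmx_mul map_mxM. Qed.

Lemma adjmxK m n (A : 'M[K]_(m, n)) : A ^t theta ^t theta = A.
Proof. by apply/matrixP => i j; rewrite !mxE thetaK. Qed.

Lemma penrose_unique m n (M : 'M[K]_(m, n)) X Y :
  penrose theta M X -> penrose theta M Y -> X = Y.
Proof.
move=> [x1 x2 x3 x4] [y1 y2 y3 y4].
have eMX : M *m X = M *m Y.
  have e : M *m X = (M *m Y) *m (M *m X) by rewrite mulmxA y1.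
  by rewrite -x3 e adjmxM x3 y3 mulmxA x1.
have eXM : X *m M = Y *m M.
  have e : X *m M = (X *m M) *m (Y *m M) by rewrite -mulmxA (mulmxA M) y1.
  by rewrite -x4 e adjmxM x4 y4 -mulmxA (mulmxA M) x1.
by rewrite -x2 -mulmxA eMX mulmxA eXM y2.
Qed.

Lemma gram_unit m n (A : 'M[K]_(m, n)) :
  row_free A -> A *m A ^t theta \in unitmx.
Proof.
move=> fA; rewrite -row_free_unit -kermx_eq0; apply/eqP/row_matrixP => i.
set v := row i _.
have v0 : v *m (A *m A ^t theta) = 0 by rewrite -row_mul mulmx_ker row0.
have /matrixP/(_ 0 0) : (v *m A) *m (v *m A) ^t theta = 0.
  by rewrite adjmxM !mulmxA -(mulmxA v) v0 mul0mx.
rewrite !mxE => /eqP; rewrite psumr_eq0; last first.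
  by move=> j _; rewrite !mxE thetaM exprn_ge0.
move=> /allP s0; suff /eqP : v *m A = 0.
  by rewrite mulmx_free_eq0 // row0 => /eqP.
apply/rowP => j; move: (s0 j (mem_index_enum _)).
by rewrite !mxE thetaM sqrf_eq0 normr_eq0 => /eqP.
Qed.

Lemma penrose_exists m n (M : 'M[K]_(m, n)) : exists X, penrose theta M X.
Proof.
have := (mulmx_base M, col_base_full M, row_base_free M).
move: (\rank M) (col_base M) (row_base M) => r C F [[eM fC] fF].
set G := F *m F ^t theta; set H := C ^t theta *m C.
have uG : G \in unitmx by exact: gram_unit.
have uH : H \in unitmx.
  rewrite /H -{2}(adjmxK C); apply: gram_unit.
  by rewrite /row_free mxrank_map mxrank_tr; exact: fC.
have adjV p (S : 'M[K]_p) : S ^t theta = S -> (invmx S) ^t theta = invmx S.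
  by move=> eS; rewrite trmx_inv map_invmx eS.
have aG : (invmx G) ^t theta = invmx G by apply: adjV; rewrite adjmxM adjmxK.
have aH : (invmx H) ^t theta = invmx H by apply: adjV; rewrite adjmxM adjmxK.
pose X := F ^t theta *m invmx G *m (invmx H *m C ^t theta).
have eMX : M *m X = C *m invmx H *m C ^t theta.
  rewrite -eM /X !mulmxA -(mulmxA C F) -/G.
  by rewrite -(mulmxA C G) mulmxV // mulmx1.
have eXM : X *m M = F ^t theta *m invmx G *m F.
  rewrite -eM /X !mulmxA -(mulmxA _ _ C) -/H.
  by rewrite -(mulmxA _ (invmx H) H) mulVmx // mulmx1.
exists X; split.
- rewrite eMX -eM mulmxA -(mulmxA _ _ C) -/H.
  by rewrite -(mulmxA C) mulVmx // mulmx1.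
- rewrite eXM /X !mulmxA -(mulmxA _ F) -/G.
  by rewrite -(mulmxA _ (invmx G) G) mulVmx // mulmx1.
- by rewrite eMX !adjmxM adjmxK aH mulmxA.
- by rewrite eXM !adjmxM adjmxK aG mulmxA.
Qed.

Lemma mpinvP m n (M : 'M[K]_(m, n)) : penrose theta M (mpinv theta M).
Proof. exact: (xgetPex 0 (penrose_exists M)). Qed.

End Existence.

Lemma mpinvP_real (R : realType) m n (M : 'M[R]_(m, n)) :
  penrose idfun M (mpinv idfun M).
Proof.
apply: (@mpinvP R (idfun : {rmorphism R -> R})) => // x.
by rewrite real_normK ?num_real // expr2.
Qed.

Lemma mpinvP_complex (R : realType) m n (M : 'M[R[i]]_(m, n)) :
  penrose Num.conj M (mpinv Num.conj M).
Proof.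
apply: (@mpinvP R[i] (Num.conj : {rmorphism R[i] -> R[i]})) => [x|].
  by rewrite -normCK.
exact: conjCK.
Qed.

(* Main.v *)
Require Import Defs.
From mathcomp Require Import all_boot all_order all_algebra.
From mathcomp Require Import reals complex.
Set Implicit Arguments.
Unset Strict Implicit.
Unset Printing Implicit Defensive.
Import Order.TTheory GRing.Theory Num.Theory.
Local Open Scope ring_scope.

(** Write X for the pseudoinverse of A B, P for B X A, and consider the
    orthogonal projections Q = B B^+ onto the range of B and E = A^+ A onto
    that of A^*. Since X A B X = X, the matrix P is always idempotent; the
    content lies in its being self-adjoint.

    If X = B^+ A^+, then P = Q E. A product of two orthogonal projections that
    is idempotent is self-adjoint, because Q E - Q E Q times its adjoint
    vanishes, whence Q E = Q E Q ([proj_mul_idem_sa]).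

    Conversely Q P = P and P E = P hold by the form of P, so for self-adjoint P
    also P Q = P and E P = P. Sandwiching A B = A P B between A^+ and B^+ then
    gives E Q = E P Q = P, and taking adjoints, P = Q E. Finally X is recovered
    from P as B^+ P A^+ ([penrose_mulE]), which equals B^+ Q E A^+ = B^+ A^+. *)

Section ReverseOrderLaw.
Local Open Scope sesquilinear_scope.
Variables (K : numFieldType) (theta : {rmorphism K -> K}).
Hypothesis thetaM : forall x, x * theta x = `|x| ^+ 2.

Let adjM := adjmxM theta.

(** The diagonal entries of Z Z^* are the squared norms of the rows of Z. *)
Lemma gram_eq0 m n (Z : 'M[K]_(m, n)) : Z *m Z ^t theta = 0 -> Z = 0.
Proof.
move=> /matrixP Z0; apply/matrixP => i j; have := Z0 i i.
rewrite !mxE => /eqP; rewrite psumr_eq0; last first.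
  by move=> l _; rewrite !mxE thetaM exprn_ge0.
move=> /allP /(_ j (mem_index_enum _)).
by rewrite !mxE thetaM sqrf_eq0 normr_eq0 => /eqP.
Qed.

(** Geometrically, Q E has norm at most one, and an idempotent of norm at most
    one is an orthogonal projection. Algebraically, the Gram matrix of
    Q E - Q E Q expands to four terms that all equal Q E Q, with signs that
    cancel; so Q E = Q E Q, which is visibly self-adjoint. *)
Lemma proj_mul_idem_sa n (Q E : 'M[K]_n) :
    orthogonal_projection theta Q -> orthogonal_projection theta E ->
  Q *m E *m (Q *m E) = Q *m E -> (Q *m E) ^t theta = Q *m E.
Proof.
move=> [QQ aQ] [EE aE] idem.
have aQE : (Q *m E) ^t theta = E *m Q by rewrite adjM aQ aE.
have aQEQ : (Q *m E *m Q) ^t theta = Q *m E *m Q by rewrite adjM aQE aQ mulmxA.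
have eS : Q *m E *m Q *m (E *m Q) = Q *m E *m Q.
  by rewrite mulmxA -(mulmxA (Q *m E) Q E) idem.
have eS' : Q *m E *m (Q *m E *m Q) = Q *m E *m Q by rewrite mulmxA idem.
have /eqP : Q *m E - Q *m E *m Q = 0.
  apply: gram_eq0; rewrite linearB map_mxB /= aQE aQEQ.
  rewrite mulmxBl !mulmxBr eS eS' -(mulmxA (Q *m E) Q (_ *m Q)).
  rewrite !(mulmxA Q) QQ eS'.
  by rewrite -(mulmxA Q E (E *m Q)) (mulmxA E) EE mulmxA !subrr.
by rewrite subr_eq0 => /eqP ->.
Qed.

Lemma penrose_projl m n (M : 'M[K]_(m, n)) X :
  penrose theta M X -> orthogonal_projection theta (M *m X).
Proof. by move=> [MXM _ aMX _]; split=> //; rewrite mulmxA MXM. Qed.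

Lemma penrose_projr m n (M : 'M[K]_(m, n)) X :
  penrose theta M X -> orthogonal_projection theta (X *m M).
Proof. by move=> [_ XMX _ aXM]; split=> //; rewrite mulmxA XMX. Qed.

(** The range of (A B)^+ lies in that of B^*, which the projection B^+ B fixes;
    dually, that of its adjoint lies in the range of A, fixed by A A^+. *)
Lemma penrose_mulE m n k (A : 'M[K]_(m, n)) (B : 'M[K]_(n, k)) Ai Bi X :
    penrose theta A Ai -> penrose theta B Bi -> penrose theta (A *m B) X ->
  X = Bi *m (B *m X *m A) *m Ai.
Proof.
move=> [A1 _ A3 _] [B1 _ _ B4] [_ X2 X3 X4].
have BX : Bi *m B *m X = X.
  have e : X *m (A *m B) *m (Bi *m B) = X *m (A *m B).
    by rewrite -!mulmxA (mulmxA B) B1.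
  have /(congr1 (fun Z => Z ^t theta)) := e; rewrite adjM B4 X4 => e'.
  by rewrite -{1}X2 mulmxA e' X2.
have XA : X *m (A *m Ai) = X.
  have e : A *m Ai *m (A *m B *m X) = A *m B *m X by rewrite !mulmxA A1.
  have /(congr1 (fun Z => Z ^t theta)) := e; rewrite adjM A3 X3 => e'.
  by rewrite -{1}X2 -(mulmxA X) -mulmxA e' mulmxA X2.
by rewrite !mulmxA BX -mulmxA XA.
Qed.

(** The conjugation enters only through [x * theta x = `|x| ^+ 2], which makes
    Gram matrices definite; this holds for the identity of the reals and for
    complex conjugation, so both fields are covered at once. *)
Lemma reverse_order_law m n k (A : 'M[K]_(m, n)) (B : 'M[K]_(n, k)) Ai Bi X :
    penrose theta A Ai -> penrose theta B Bi -> penrose theta (A *m B) X ->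
  X = Bi *m Ai <-> orthogonal_projection theta (B *m X *m A).
Proof.
move=> pA pB pX; have eX := penrose_mulE pA pB pX.
have [A1 A2 _ A4] := pA; have [B1 B2 B3 _] := pB; have [X1 X2 _ _] := pX.
split=> [e|[_]].
  have idem : B *m X *m A *m (B *m X *m A) = B *m X *m A.
    by rewrite -{3}X2 !mulmxA.
  split=> //; have eP : B *m X *m A = B *m Bi *m (Ai *m A) by rewrite e !mulmxA.
  rewrite eP in idem *.
  exact: proj_mul_idem_sa (penrose_projl pB) (penrose_projr pA) idem.
have APB : A *m (B *m X *m A) *m B = A *m B by move: X1; rewrite !mulmxA.
have QP : B *m Bi *m (B *m X *m A) = B *m X *m A by rewrite !mulmxA B1.
have PE : B *m X *m A *m (Ai *m A) = B *m X *m A.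
  by rewrite -!mulmxA (mulmxA A) A1.
move: (B *m X *m A) eX APB QP PE => P eX APB QP PE aP.
have PQ : P *m (B *m Bi) = P by rewrite -{1}aP -{1}B3 -adjM QP aP.
have EP : Ai *m A *m P = P by rewrite -{1}aP -{1}A4 -adjM PE aP.
have PEQ : P = Ai *m A *m (B *m Bi).
  by rewrite mulmxA -(mulmxA Ai A B) -APB !mulmxA EP -mulmxA PQ.
have PQE : P = B *m Bi *m (Ai *m A) by rewrite -aP PEQ adjM A4 B3.
by rewrite eX PQE !mulmxA B2 -!mulmxA (mulmxA Ai) A2.
Qed.

End ReverseOrderLaw.

Theorem lemma6p3 (R : realType) (m n k : nat) :
  (forall (A : 'M[R]_(m, n)) (B : 'M[R]_(n, k)),
     mpinv idfun (A *m B) = mpinv idfun B *m mpinv idfun A <->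
     orthogonal_projection idfun (B *m mpinv idfun (A *m B) *m A)) /\
  (forall (A : 'M[R[i]]_(m, n)) (B : 'M[R[i]]_(n, k)),
     mpinv Num.conj (A *m B) = mpinv Num.conj B *m mpinv Num.conj A <->
     orthogonal_projection Num.conj (B *m mpinv Num.conj (A *m B) *m A)).
Proof.
split=> A B.
  apply: (@reverse_order_law R (idfun : {rmorphism R -> R})).
  - by move=> x; rewrite real_normK ?num_real // expr2.
  - exact: mpinvP_real.
  - exact: mpinvP_real.
  - exact: mpinvP_real.
apply: (@reverse_order_law R[i] (Num.conj : {rmorphism R[i] -> R[i]})).
- by move=> x; rewrite -normCK.
- exact: mpinvP_complex.
- exact: mpinvP_complex.
- exact: mpinvP_complex.
Qed.
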